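(* Let $i\ge 3$ and $k\ge 3$ be integers. Then: (a) $g_3(F_i,F_{i+2},F_{i+k})=(4F_i-1)F_{i+2}-F_i$ whenever $k\ge i+3$; (b) $g_3(F_i,F_{i+2},F_{2i+2})=(F_i-1)F_{i+2}+F_{2i+2}-F_i$; (c) $g_3(F_i,F_{i+2},F_{2i+1})=(F_i+F_{i-2}-1)F_{i+2}+F_{2i+1}-F_i$; (d) $g_3(F_i,F_{i+2},F_{2i})=(F_i-1)F_{i+2}+2F_{2i}-F_i$; (e) $g_3(F_i,F_{i+2},F_{2i-1})=(F_{i-2}-1)F_{i+2}+3F_{2i-1}-F_i$ for $i\ge 4$; (f) $g_3(F_i,F_{i+2},F_{2i-2})=(F_{i-5}-1)F_{i+2}+5F_{2i-2}-F_i$ for $i\ge 6$, and $g_3(F_5,F_7,F_8)=F_7+4F_8-F_5=92$; (g) if $r=\lfloor (F_i-1)/F_k\rfloor\ge 3$ (equivalently $k\le i-3$), then $$g_3(F_i,F_{i+2},F_{i+k})=\begin{cases}(F_i-rF_k-1)F_{i+2}+(r+3)F_{i+k}-F_i & \text{if } (F_i-rF_k)F_{i+2}\ge F_{k-2}F_i,\\ (F_k-1)F_{i+2}+(r+2)F_{i+k}-F_i & \text{if } (F_i-rF_k)F_{i+2}< F_{k-2}F_i.\end{cases}$$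
   Context: Fibonacci numbers: $F_0=0$, $F_1=1$, $F_n=F_{n-1}+F_{n-2}$. For positive integers $a_1,\dots,a_l$ with $\gcd(a_1,\dots,a_l)=1$ and an integer $n$, let $d(n;a_1,\dots,a_l)$ be the number of tuples $(x_1,\dots,x_l)$ of nonnegative integers with $a_1x_1+\dots+a_lx_l=n$. For a nonnegative integer $p$, the $p$-Frobenius number $g_p(a_1,\dots,a_l)$ is the largest integer $n$ with $d(n;a_1,\dots,a_l)\le p$. *)

(* Defs.v *)
From mathcomp Require Import all_boot all_order all_algebra.
Set Implicit Arguments. Unset Strict Implicit. Unset Printing Implicit Defensive.
Import Order.TTheory GRing.Theory Num.Theory.

Fixpoint fib (n : nat) : nat :=
  match n with
  | 0 => 0
  | 1 => 1
  | (m.+1 as n').+1 => fib n' + fib m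
  end.

(* d(n; a_1,...,a_l) for n : nat and positive generators a = [:: a_1; ...; a_l]:
   the number of tuples (x_1,...,x_l) of nonnegative integers with
   a_1 x_1 + ... + a_l x_l = n.  Since every a_j >= 1, each x_j <= n, so the
   tuples can be taken in 'I_(n+1)^l without loss. *)
Definition dnat (n : nat) (a : seq nat) : nat :=
  #|[set x : {ffun 'I_(size a) -> 'I_n.+1} |
      (\sum_(j < size a) nth 0 a j * x j)%N == n]|.

Definition dZ (n : int) (a : seq nat) : nat :=
  match n with
  | Posz m => dnat m a
  | Negz _ => 0
  end.

Definition is_pFrobenius (p : nat) (a : seq nat) (g : int) : Prop :=
  (dZ g a <= p)%N /\ (forall n : int, (g < n)%R -> (p < dZ n a)%N).

(* Main.v *)
(* Write a = F_i, b = F_(i+2), c = F_(i+k), q = F_k, s = F_(k-2).  Then a and b are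
   coprime and c = q b - s a, so for n = m b (mod a) with 0 <= m < a a representation
   n = a x + b y + c z is determined by z and by t, where y + q z = m + t a: the
   number b y + c z = b (m + t a) - s a z has to be at most n.  Hence g_p + a is the
   maximum over m of the (p+1)-st smallest value of b (m + t a) - s a z on the pairs
   (t, z) with q z <= m + t a.  In each case of the theorem p = 3, and one exhibits
   the maximizing m with its three pairs below the maximum, and for every other residue
   four pairs at or below it. *)
Require Import Defs.
From mathcomp Require Import all_boot all_order all_algebra.
From mathcomp Require Import zify ring.
Import Order.TTheory GRing.Theory Num.Theory.
Local Open Scope ring_scope.

(** * Counting representations by three generators *)

Section ThreeGenerators.
Local Open Scope nat_scope.

Definition eval3 n (x : {ffun 'I_3 -> 'I_n.+1}) : nat * nat * nat :=
  (x ord0 : nat, x (inord 1) : nat, x ord_max : nat).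

Lemma sum_nth3 n a b c (x : {ffun 'I_3 -> 'I_n.+1}) :
  \sum_(j < 3) nth 0 [:: a; b; c] j * x j =
  a * (eval3 n x).1.1 + b * (eval3 n x).1.2 + c * (eval3 n x).2.
Proof.
rewrite !big_ord_recl big_ord0 addn0 /eval3 /= addnA.
by congr (_ + _ * nat_of_ord (x _) + _ * nat_of_ord (x _)); apply: val_inj; rewrite //= inordK.
Qed.

Lemma eval3_inj n : injective (eval3 n).
Proof.
move=> x y [h0 h1 h2]; apply/ffunP => -[[|[|[|//]]] hj]; apply: val_inj.
- by move: h0; congr (nat_of_ord (x _) = nat_of_ord (y _)); apply: val_inj.
- by move: h1; congr (nat_of_ord (x _) = nat_of_ord (y _)); apply: val_inj; rewrite /= inordK.
- by move: h2; congr (nat_of_ord (x _) = nat_of_ord (y _)); apply: val_inj.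
Qed.

Lemma eval3_surj n x y z : x <= n -> y <= n -> z <= n ->
  exists f, eval3 n f = (x, y, z).
Proof.
move=> hx hy hz.
exists [ffun j : 'I_3 => inord (nth 0 [:: x; y; z] j)].
by rewrite /eval3 !ffunE /= !inordK //= ltnS.
Qed.

(** As [a] is positive, [x] is determined by [y] and [z], so solutions inject into [l] by their last
    two coordinates. *)
Lemma dnat3_leq n a b c (l : seq (nat * nat)) : 0 < a ->
  (forall x y z, a * x + b * y + c * z = n -> (y, z) \in l) ->
  dnat n [:: a; b; c] <= size l.
Proof.
move=> a0 hl; rewrite /dnat cardE.
set S := enum _.
pose yz x := ((eval3 n x).1.2, (eval3 n x).2).
have inS x : x \in S ->
    a * (eval3 n x).1.1 + b * (eval3 n x).1.2 + c * (eval3 n x).2 = n.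
  by rewrite mem_enum inE sum_nth3 => /eqP.
rewrite -(size_map yz); apply: uniq_leq_size.
  rewrite map_inj_in_uniq ?enum_uniq // => x y /inS hx /inS hy.
  rewrite /yz => /eqP; rewrite xpair_eqE => /andP[/eqP h1 /eqP h2].
  apply: eval3_inj; move: hx hy h1 h2.
  case: (eval3 n x) => [[x0 x1] x2]; case: (eval3 n y) => [[y0 y1] y2] /=.
  move=> hx hy h1 h2; rewrite -h1 -h2 in hy *; congr (_, _, _).
  by apply/eqP; rewrite -(eqn_pmul2l a0); apply/eqP; lia.
by move=> _ /mapP[x /inS /hl hx ->].
Qed.

(** Positive coefficients keep every coordinate at most [n], so each solution fits in the bounded
    tuples counted by [dnat]. *)
Lemma dnat3_geq n a b c (l : seq (nat * nat)) : 0 < a -> 0 < b -> 0 < c ->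
  uniq l ->
  (forall y z, (y, z) \in l -> exists x, a * x + b * y + c * z = n) ->
  size l <= dnat n [:: a; b; c].
Proof.
move=> a0 b0 c0 ul hl; rewrite /dnat cardE.
set S := enum _.
pose yz x := ((eval3 n x).1.2, (eval3 n x).2).
rewrite -(size_map yz S); apply: uniq_leq_size => // -[y z] /hl [x hx].
have [||| f hf] := @eval3_surj n x y z; try by nia.
apply/mapP; exists f; last by rewrite /yz hf.
by rewrite mem_enum inE sum_nth3 hf /= hx.
Qed.

End ThreeGenerators.

(** * From residues modulo [a] to p-Frobenius numbers *)

(* The two inequalities say that y = m + t a - q z is nonnegative and, after
   division by a, that x is.  The triple (m, t0, z0) codes the value g + a. *)
Definition extremal (p a b q s m t0 z0 : nat) : Prop :=
  [/\ (m < a)%N,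
      exists2 l : seq (nat * nat), (size l <= p)%N &
        forall t z, (q * z <= m + t * a)%N ->
          (t * b + s * z0 < t0 * b + s * z)%N -> (t, z) \in l &
      forall m', (m' < a)%N -> exists2 l : seq (nat * nat),
        uniq l /\ size l = p.+1 &
        all (fun tz => (q * tz.2 <= m' + tz.1 * a)%N &&
          (b * (m' + tz.1 * a) + s * a * z0
             <= b * (m + t0 * a) + s * a * tz.2)%N) l].

(** The lower list catches every representation of [g]; for [n > g] the upper list of the residue of
    [n] yields [p.+1] representations. *)
Lemma pFrobenius3_criterion (p a b c q s m t0 z0 : nat) (g : int) :
  (0 < a)%N -> (0 < b)%N -> (0 < c)%N -> coprime a b ->
  (c + s * a = q * b)%N -> extremal p a b q s m t0 z0 ->
  g + a%:Z + s%:Z * a%:Z * z0%:Z = b%:Z * (m%:Z + t0%:Z * a%:Z) ->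
  is_pFrobenius p [:: a; b; c] g.
Proof.
move=> a0 b0 c0 cab hc [ma [l sl lower] upper] hg.
have [u [v huv]] : exists u v : int, u * b%:Z + v * a%:Z = 1.
  have [u [v huv]] := Bezoutz b a; exists u, v; rewrite huv.
  by rewrite /gcdz !absz_nat gcdnC (eqP cab).
split.
  case: g hg => [n|//] hg; rewrite /dZ; apply: leq_trans sl.
  rewrite -(size_map (fun tz => (m + tz.1 * a - q * tz.2, tz.2)%N) l).
  apply: dnat3_leq => // x y z hn.
  pose M := (y + q * z)%N.
  have hM : (a * x + b * M + a + s * a * z0 = b * (m + t0 * a) + s * a * z)%N.
    rewrite /M; nia.
  (* By [hM], b (M - m) is a times the first bracket, so the Bezout relation gives the quotient of M
     - m by a explicitly. *)
  pose t := u * (s%:Z * z%:Z + b%:Z * t0%:Z - x%:Z - 1 - s%:Z * z0%:Z)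
            + v * (M%:Z - m%:Z).
  have ht : M%:Z - m%:Z = t * a%:Z.
    have -> : M%:Z - m%:Z = (u * b%:Z + v * a%:Z) * (M%:Z - m%:Z).
      by rewrite huv mul1r.
    have hM' : b%:Z * (M%:Z - m%:Z) =
        a%:Z * (s%:Z * z%:Z + b%:Z * t0%:Z - x%:Z - 1 - s%:Z * z0%:Z) by nia.
    by rewrite mulrDl -mulrA hM' /t; ring.
  (* M >= 0 and m < a give t a > -a. *)
  have t_ge0 : 0 <= t by nia.
  case: t t_ge0 ht {huv} => // t _ ht.
  have ht' : (M = m + t * a)%N by lia.
  apply/mapP; exists (t, z); last by rewrite /= -ht' /M addnK.
  apply: lower; first by rewrite -ht' leq_addl.
  (* Strictness comes from the summand a x + a >= a. *)
  by rewrite ht' in hM; rewrite -(ltn_pmul2l a0); lia.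
move=> n hn.
(* As u inverts b modulo a, n is congruent to b m1. *)
pose m1 := ((n * u) %% a%:Z)%Z.
have m1_ge0 : 0 <= m1 by apply: modz_ge0; lia.
have m1_lt : m1 < a%:Z by apply: ltz_pmod; lia.
pose N := b%:Z * ((n * u) %/ a%:Z)%Z + v * n.
have hN : n = b%:Z * m1 + a%:Z * N.
  have hd := divz_eq (n * u) a%:Z.
  rewrite -/m1 in hd.
  have -> : b%:Z * m1 = b%:Z * (n * u - ((n * u) %/ a%:Z)%Z * a%:Z).
    by congr (_ * _); move: hd; set qq := (_ %/ _)%Z; lia.
  rewrite -[LHS]mul1r -huv /N; ring.
case: m1 m1_ge0 m1_lt hN => // m' _ m'a hN.
have [|l' [ul' sl'] al'] := upper m'; first by lia.
pose yz (tz : nat * nat) := (m' + tz.1 * a - q * tz.2, tz.2)%N.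
have sol t z : (t, z) \in l' -> (q * z <= m' + t * a)%N /\
    exists x : nat, (a * x + b * (m' + t * a - q * z) + c * z)%:Z = n.
  move=> /(allP al') /= /andP[h1 h2]; split=> //.
  pose x := N - t%:Z * b%:Z + s%:Z * z%:Z.
  have ax : a%:Z * x = n - b%:Z * (m' + t * a)%:Z + s%:Z * a%:Z * z%:Z.
    rewrite hN /x; lia.
  (* n > g and the bound on (t, z) give a x > -a. *)
  have : 0 <= x.
    have : - a%:Z < a%:Z * x by lia.
    nia.
  case: x ax => // x ax _; exists x.
  nia.
have [n0 hn0] : exists n0 : nat, n = n0.
  case: l' sl' sol {ul' al'} => // -[t z] l' _ /(_ t z).
  by rewrite inE eqxx => /(_ isT) [_ [x <-]]; eexists.
rewrite hn0 -sl' -(size_map yz); apply: dnat3_geq => //.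
  rewrite map_inj_in_uniq // => -[t1 z1] [t2 z2] /sol[h1 _] /sol[h2 _].
  case=> h3 h4; subst z2; congr (_, _).
  by apply/eqP; rewrite -(eqn_pmul2r a0); apply/eqP; lia.
move=> y z /mapP[[t z'] /sol[h1 [x hx]] [-> ->]]; exists x.
by apply/eqP; rewrite -eqz_nat hx hn0.
Qed.

(** * Fibonacci identities *)

Section Fibonacci.
Local Open Scope nat_scope.

Lemma fibSS n : fib n.+2 = fib n.+1 + fib n.
Proof. by []. Qed.

Lemma fib_gt0 n : 0 < fib n.+1.
Proof. by elim: n => [//|n ih]; rewrite fibSS addn_gt0 ih. Qed.

Lemma leq_fib m n : m <= n -> fib m <= fib n.
Proof.
move/subnK <-; elim: (n - m) => // d; rewrite addSn => /leq_trans; apply.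
by case: (d + m) => // j; rewrite fibSS leq_addr.
Qed.

Lemma coprime_fib2 n : coprime (fib n) (fib n.+2).
Proof.
have h : coprime (fib n) (fib n.+1).
  elim: n => [//|n ih].
  by rewrite fibSS /coprime gcdnDl gcdnC.
by rewrite fibSS /coprime gcdnDr.
Qed.

(** The relation c = q b - s a, with k shifted by 2. Both sides obey the Fibonacci recurrence in k,
    hence the induction on two consecutive k. *)
Lemma fib_skip2 i k :
  fib (i + k.+2) + fib k * fib i = fib k.+2 * fib i.+2.
Proof.
have [] : fib (i + k.+2) + fib k * fib i = fib k.+2 * fib i.+2 /\
  fib (i + k.+3) + fib k.+1 * fib i = fib k.+3 * fib i.+2; last by [].
elim: k => [|k [h1 h2]].
  by rewrite !addnS addn0 !fibSS (_ : fib 0 = 0) // (_ : fib 1 = 1) //; lia.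
split=> //; rewrite !addnS in h1 h2 *; rewrite (fibSS (i + k).+2) (fibSS k.+2).
by have : fib k.+2 * fib i = fib k.+1 * fib i + fib k * fib i;
  [rewrite fibSS mulnDl | lia].
Qed.

End Fibonacci.

Lemma pFrobenius3_fib_criterion (p i k m t0 z0 : nat) (g : int) :
  (0 < i)%N -> (2 <= k)%N ->
  extremal p (fib i) (fib (i + 2)) (fib k) (fib (k - 2)) m t0 z0 ->
  g = (fib (i + 2))%:Z * (m%:Z + t0%:Z * (fib i)%:Z)
      - (fib (k - 2))%:Z * (fib i)%:Z * z0%:Z - (fib i)%:Z ->
  is_pFrobenius p [:: fib i; fib (i + 2); fib (i + k)] g.
Proof.
case: i => // i _; case: k => [|[|k]] // _ ext ->.
apply: pFrobenius3_criterion ext _.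
- exact: fib_gt0.
- by rewrite addn2 fib_gt0.
- by rewrite addSn fib_gt0.
- by rewrite addn2 coprime_fib2.
- by rewrite addn2 subn2 fib_skip2.
- by lia.
Qed.

(** * Extremal residues in each case *)

Ltac exhibit w := exists w => //=; rewrite andbT; repeat (apply/andP; split).

Section Extremal.
Local Open Scope nat_scope.

Lemma extremal_case_a a b q s :
  0 < a -> 5 * a <= 2 * b -> 4 * a <= q -> 2 * s <= q ->
  extremal 3 a b q s (a.-1) 3 0.
Proof.
move=> a0 hb hq hs; split; first by lia.
- exists [:: (0, 0); (1, 0); (2, 0)] => // t [|z] h1 h2.
    have {h1 h2} : t < 3 by nia.
    by case: t => [|[|[|]]].
  exfalso.
  have t4 : 4 <= t by nia.
  (* With q z <= (t + 1) a and q b >= 5 s a this forces 5 (t - 3) < t + 1, against t >= 4. *)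
  have h3 : q * (t - 3) * b < s * (q * z.+1) by nia.
  have h4 : s * (q * z.+1) <= s * (t.+1 * a) by nia.
  have h5 : 5 * (t - 3) * (s * a) <= q * (t - 3) * b by nia.
  nia.
- by move=> m hm; exhibit [:: (0, 0); (1, 0); (2, 0); (3, 0)]; nia.
Qed.

(** Here a = F_i and e = F_(i-1). The pair (2, 1) is admissible exactly when m >= e; below e the
    fourth pair is (3, 1), and e - 1 is the worst residue. *)
Lemma extremal_case_b a e : 0 < e -> e < a -> a <= 2 * e ->
  extremal 3 a (2 * a + e) (2 * a + e) a (e.-1) 3 1.
Proof.
move=> e0 ea ae; split; first by lia.
- exists [:: (0, 0); (1, 0); (2, 0)] => // t [|z] h1 h2.
    have {h1 h2} : t < 3 by nia.
    by case: t => [|[|[|]]].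
  exfalso.
  have t4 : 2 * z.+1 + 1 <= t by nia.
  nia.
- move=> m hm; case: (leqP e m) => h.
    by exhibit [:: (0, 0); (1, 0); (2, 0); (2, 1)]; nia.
  by exhibit [:: (0, 0); (1, 0); (2, 0); (3, 1)]; nia.
Qed.

(** Here e = F_(i-1) and f = F_(i-2). The pair (1, 1) is admissible exactly when m >= e; below e,
    (2, 0) replaces it. *)
Lemma extremal_case_c e f : 0 < f -> f <= e -> e <= 2 * f ->
  extremal 3 (e + f) (3 * e + 2 * f) (2 * e + f) e (e + f).-1 2 1.
Proof.
move=> f0 fe ef; split; first by lia.
- exists [:: (0, 0); (1, 0); (1, 1)] => // t [|[|z]] h1 h2.
  + have {h1 h2} : t < 2 by nia.
    by case: t => [|[|]].
  + have {h1 h2} : 0 < t < 2 by nia.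
    by case: t => [|[|]].
  exfalso.
  have : z.+2 + 1 <= t by nia.
  nia.
- move=> m hm; case: (leqP e m) => h.
    by exhibit [:: (0, 0); (1, 0); (1, 1); (2, 1)]; nia.
  by exhibit [:: (0, 0); (1, 0); (2, 0); (2, 1)]; nia.
Qed.

(** Since q = a, admissibility for m < a is just z <= t, so the same four pairs serve all
    residues. *)
Lemma extremal_case_d a b s : 0 < a -> 2 * s <= b -> s < b ->
  extremal 3 a b a s a.-1 2 2.
Proof.
move=> a0 sb sb'; split; first by lia.
- exists [:: (0, 0); (1, 0); (1, 1)] => // t z h1 h2.
  have zt : z <= t by nia.
  have {h1 h2} : t < 2 by nia.
  by case: t zt => [|[|t]]; case: z => [|[|z]].
- by move=> m hm; exhibit [:: (0, 0); (1, 0); (1, 1); (2, 2)]; nia.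
Qed.

(** Here f = F_(i-2) and h = F_(i-3). The pair (0, 1) needs m >= q, and (1, 2) needs m >= 2 q - a =
    h; below h the fourth pair is (2, 3). *)
Lemma extremal_case_e f h : 0 < h -> h <= f ->
  extremal 3 (2 * f + h) (5 * f + 3 * h) (f + h) h h.-1 2 3.
Proof.
move=> h0 hf; split; first by lia.
- exists [:: (0, 0); (1, 0); (1, 1)] => // t z h1 h2.
  have z4 : z < 4 by nia.
  have t2 : t < 2 by nia.
  by case: t t2 h1 {h2} => [|[|t]] _ //; case: z z4 => [|[|[|[|z]]]] _ //=; nia.
- move=> m hm; case: (leqP (f + h) m) => h1.
    by exhibit [:: (0, 0); (0, 1); (1, 1); (1, 2)]; nia.
  case: (leqP h m) => h2.
    by exhibit [:: (0, 0); (1, 0); (1, 1); (1, 2)]; nia.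
  by exhibit [:: (0, 0); (1, 0); (1, 1); (2, 3)]; nia.
Qed.

(** Here u = F_(i-4), v = F_(i-5) and a = 2 q + u + v, so m has quotient at most 2 by q. The
    threshold 5 u + 2 v is 5 q - a, where (1, 5) becomes admissible. *)
Lemma extremal_case_f u v : 0 < v -> v <= u -> u <= 2 * v ->
  extremal 3 (5 * u + 3 * v) (13 * u + 8 * v) (2 * u + v) u (5 * u + 3 * v).-1 1 5.
Proof.
move=> v0 vu uv; split; first by lia.
- exists [:: (0, 0); (0, 1); (0, 2)] => // t z h1 h2.
  have z4 : z < 6 by nia.
  have t2 : t = 0 by nia.
  subst t; have {z4 h2} : z < 3 by nia.
  by case: z {h1} => [|[|[|z]]].
- move=> m hm; case: (leqP (2 * (2 * u + v)) m) => h1.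
    case: (leqP (5 * u + 2 * v) m) => h2.
      by exhibit [:: (0, 0); (0, 1); (0, 2); (1, 5)]; nia.
    by exhibit [:: (0, 0); (0, 1); (0, 2); (1, 4)]; nia.
  case: (leqP (2 * u + v) m) => h2.
    by exhibit [:: (0, 0); (0, 1); (1, 2); (1, 3)]; nia.
  by exhibit [:: (0, 0); (1, 0); (1, 1); (1, 2)]; nia.
Qed.

(** Now F_(i-5) = 0 and m + a <= 9 < 5 q, so z stops at 4 for t = 1. *)
Lemma extremal_5_13_21 : extremal 3 5 13 2 1 4 1 4.
Proof.
split=> //.
- exists [:: (0, 0); (0, 1); (0, 2)] => // t z h1 h2.
  have {h2} h : t = 0 /\ z < 3 by lia.
  by case: h h1 => ->; case: z => [|[|[|z]]].
- case=> [|[|[|[|[|//]]]]] _.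
  + by exhibit [:: (0, 0); (1, 0); (1, 1); (1, 2)].
  + by exhibit [:: (0, 0); (1, 0); (1, 1); (1, 2)].
  + by exhibit [:: (0, 0); (0, 1); (1, 1); (1, 2)].
  + by exhibit [:: (0, 0); (0, 1); (1, 3); (1, 4)].
  + by exhibit [:: (0, 0); (0, 1); (0, 2); (1, 4)].
Qed.

(* The last two hypotheses bound, in terms of (m0, z0), the values of
   b y + c z at (y, z) = (w - 1, r + 3) and (q - 1, r + 2); the maximum in case
   (g) is the larger of these two. *)
Lemma extremal_case_g (a b q s w r m0 z0 : nat) :
  a = r * q + w ->
  0 < w -> w <= q -> 2 * s <= q -> 2 * a <= b -> 3 <= r -> 3 <= z0 -> 0 < s ->
  m0 < 3 * q -> m0 + a < z0.+1 * q ->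
  b * (w.-1 + (r + 3) * q) + s * a * z0 <= b * (m0 + 1 * a) + (r + 3) * (s * a) ->
  b * (q.-1 + (r + 2) * q) + s * a * z0 <= b * (m0 + 1 * a) + (r + 2) * (s * a) ->
  extremal 3 a b q s m0 1 z0.
Proof.
move=> aE w0 wq sq ab r3 z03 s0 m0q m0a B1 B2.
(* Equivalently c >= 3 s a, the source of the factors 3 in [good]. *)
have SQ : 4 * (s * a) <= q * b.
  by have := leq_mul sq ab; rewrite mulnACA.
have a0 : 0 < a by lia.
have rq : 3 * q <= r * q by rewrite leq_mul2r r3 orbT.
split; first by lia.
(* For t = 0, m0 < 3 q leaves z <= 2; t = 1 would need z > z0, too large for m0 + a; t >= 2
   contradicts [SQ]. *)
- exists [:: (0, 0); (0, 1); (0, 2)] => // -[|[|t]] z h1 h2.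
  + have {h1 h2} : z < 3 by rewrite -(@ltn_pmul2l q); lia.
    by case: z => [|[|[|]]].
  + exfalso.
    have zz : z0 < z by rewrite -(@ltn_pmul2l s) //; lia.
    have : q * z0.+1 <= q * z by rewrite leq_mul2l zz orbT.
    by lia.
  exfalso.
  clear B1 B2 m0a.
  have h3 : q * (t.+1 * b) + q * (s * z0) < s * (q * z) by nia.
  have h4 : s * (q * z) <= s * m0 + t.+2 * (s * a) by nia.
  have h5 : s * m0 <= q * (s * z0) by nia.
  by nia.
(* With Q = z + j the value is b y + c Q + j s a. Raising Q by D adds D c >= 3 D s a, which pays for
   j <= 3 D; the targets are Q = r + 3 with y < w and Q = r + 2 with y < q. *)
have good m t z j y : m + t * a = (z + j) * q + y ->
    y < w /\ 3 * (z + j) + j <= 3 * (r + 3) \/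
    y < q /\ 3 * (z + j) + j <= 3 * (r + 2) ->
    (q * z <= m + t * a) &&
    (b * (m + t * a) + s * a * z0 <= b * (m0 + 1 * a) + s * a * z).
  move=> -> hy; rewrite [q * z]mulnC mulnDl -addnA leq_addr /= addnA -mulnDl.
  have key D x : y < x -> j <= 3 * D ->
      b * ((z + j) * q + y) + (z + j + D) * (s * a) <=
      b * (x.-1 + (z + j + D) * q) + s * a * z.
    move=> yx jD.
    have h1 : b * y <= b * x.-1 by rewrite leq_mul2l; lia.
    have h2 : (D + j) * (s * a) <= D * (q * b).
      by apply: leq_trans (_ : D * (4 * (s * a)) <= _);
        [rewrite (mulnA D 4) leq_mul2r; lia
        | rewrite leq_mul2l SQ orbT].
    by clear -h1 h2; nia.
  case: hy => -[y1 y2].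
    have := key (r + 3 - (z + j)) w y1; rewrite subnKC; last by lia.
    by move=> /(_ ltac:(lia)); clear -B1; lia.
  have := key (r + 2 - (z + j)) q y1; rewrite subnKC; last by lia.
  by move=> /(_ ltac:(lia)); clear -B2; lia.
move=> m ma.
have q0 : 0 < q by lia.
have := divn_eq m q; have := ltn_pmod m q0.
set y := m %% q; set z := m %/ q => yq mE.
(* For z >= 3 four pairs with t = 0 suffice; otherwise t = 0 gives z + 1 pairs and t = 1 the other 3
   - z, counted down from the quotient Z of m + a by q. *)
case: (leqP 3 z) => z3.
  have zr : z < r \/ (z = r /\ y < w).
    case: (ltnP z r); first by left.
    move=> rz; right; have zr : z = r.
      by apply/eqP; rewrite eqn_leq rz -ltnS -(@ltn_pmul2r q) // mulSn; lia.
    by split=> //; rewrite zr in mE; lia.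
  exists [:: (0, z); (0, z - 1); (0, z - 2); (0, z - 3)].
    by rewrite /= !inE !xpair_eqE; split=> //; lia.
  rewrite /= andbT; apply/and4P.
  split; [apply: (good _ _ _ 0 y) | apply: (good _ _ _ 1 y)
         | apply: (good _ _ _ 2 y) | apply: (good _ _ _ 3 y)];
    by [rewrite addn0 -mE | rewrite addn0; lia | rewrite subnK -?mE //; lia | lia].
have [Z [y' [hZ ZE hy']]] : exists Z y', [/\ r <= Z, m + 1 * a = Z * q + y' &
    y' < w /\ Z = z + r.+1 \/ y' < q /\ Z = z + r].
  case: (ltnP (y + w) q) => h.
    by exists (z + r), (y + w); split; [lia | rewrite mE aE; lia | right].
  by exists (z + r.+1), (y + w - q); split; [lia | rewrite mE aE; lia | left; lia].
have t0good j : j <= z -> (q * (z - j) <= m + 0 * a) &&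
    (b * (m + 0 * a) + s * a * z0 <= b * (m0 + 1 * a) + s * a * (z - j)).
  move=> jz; apply: (good _ _ _ j y); first by rewrite subnK // mE mul0n addn0.
  by lia.
have t1good j : j + z <= 2 -> (q * (Z - j) <= m + 1 * a) &&
    (b * (m + 1 * a) + s * a * z0 <= b * (m0 + 1 * a) + s * a * (Z - j)).
  move=> jz; apply: (good _ _ _ j y'); first by rewrite subnK // ; lia.
  by lia.
have : z = 0 \/ z = 1 \/ z = 2 by lia.
case=> [z_0 | [z_1 | z_2]].
- exists [:: (0, z - 0); (1, Z - 0); (1, Z - 1); (1, Z - 2)].
    by rewrite /= !inE !xpair_eqE; split=> //; lia.
  by rewrite /= andbT; apply/and4P; split; (apply: t0good || apply: t1good); lia.
- exists [:: (0, z - 0); (0, z - 1); (1, Z - 0); (1, Z - 1)].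
    by rewrite /= !inE !xpair_eqE; split=> //; lia.
  by rewrite /= andbT; apply/and4P; split; (apply: t0good || apply: t1good); lia.
- exists [:: (0, z - 0); (0, z - 1); (0, z - 2); (1, Z - 0)].
    by rewrite /= !inE !xpair_eqE; split=> //; lia.
  by rewrite /= andbT; apply/and4P; split; (apply: t0good || apply: t1good); lia.
Qed.
End Extremal.


(** * The cases of the theorem for Fibonacci triples *)

(** The addition formula; [p] and [q] are passed as numerals so that the expansions are linear for
    [lia]. *)
Lemma fib_linear (n i d p q : nat) : n = (i + d.+1)%N ->
  fib d.+1 = p -> fib d = q -> fib n = (p * fib i.+1 + q * fib i)%N.
Proof.
move=> -> <- <-.
have [] : (fib (i + d.+1) = fib d.+1 * fib i.+1 + fib d * fib i /\
  fib (i + d.+2) = fib d.+2 * fib i.+1 + fib d.+1 * fib i)%N; last by [].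
elim: d => [|d [h1 h2]].
  by rewrite !addnS addn0 !fibSS (_ : fib 0 = 0%N) // (_ : fib 1 = 1%N) //; lia.
split=> //; rewrite !addnS in h1 h2 *; rewrite fibSS h1 h2 (fibSS d.+1) [fib d.+2]fibSS.
by lia.
Qed.

Theorem theorem4 (i k : nat) (hi : (3 <= i)%N) (hk : (3 <= k)%N) :
  let F n := ((fib n)%:Z : int) in
  (* (a) *)
  ((i + 3 <= k)%N ->
     is_pFrobenius 3 [:: fib i; fib (i + 2)%N; fib (i + k)%N]
       ((4 * F i - 1) * F (i + 2)%N - F i)) /\
  (* (b) *)
  is_pFrobenius 3 [:: fib i; fib (i + 2)%N; fib (2 * i + 2)%N]
    ((F i - 1) * F (i + 2)%N + F (2 * i + 2)%N - F i) /\
  (* (c) *)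
  is_pFrobenius 3 [:: fib i; fib (i + 2)%N; fib (2 * i + 1)%N]
    ((F i + F (i - 2)%N - 1) * F (i + 2)%N + F (2 * i + 1)%N - F i) /\
  (* (d) *)
  is_pFrobenius 3 [:: fib i; fib (i + 2)%N; fib (2 * i)%N]
    ((F i - 1) * F (i + 2)%N + 2 * F (2 * i)%N - F i) /\
  (* (e) *)
  ((4 <= i)%N ->
     is_pFrobenius 3 [:: fib i; fib (i + 2)%N; fib (2 * i - 1)%N]
       ((F (i - 2)%N - 1) * F (i + 2)%N + 3 * F (2 * i - 1)%N - F i)) /\
  (* (f) *)
  ((6 <= i)%N ->
     is_pFrobenius 3 [:: fib i; fib (i + 2)%N; fib (2 * i - 2)%N]
       ((F (i - 5)%N - 1) * F (i + 2)%N + 5 * F (2 * i - 2)%N - F i)) /\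
  (is_pFrobenius 3 [:: fib 5; fib 7; fib 8] (F 7%N + 4 * F 8%N - F 5%N) /\
   F 7%N + 4 * F 8%N - F 5%N = 92) /\
  (* (g) *)
  (let r := ((fib i).-1 %/ fib k)%N in
   (3 <= r)%N ->
   ((((fib i - r * fib k) * fib (i + 2)%N >= fib (k - 2)%N * fib i)%N ->
       is_pFrobenius 3 [:: fib i; fib (i + 2)%N; fib (i + k)%N]
         ((F i - r%:Z * F k - 1) * F (i + 2)%N + (r%:Z + 3) * F (i + k)%N - F i)) /\
    (((fib i - r * fib k) * fib (i + 2)%N < fib (k - 2)%N * fib i)%N ->
       is_pFrobenius 3 [:: fib i; fib (i + 2)%N; fib (i + k)%N]
         ((F k - 1) * F (i + 2)%N + (r%:Z + 2) * F (i + k)%N - F i)))).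
Proof.
move=> F; rewrite {}/F.
have fi0 : (0 < fib i)%N by case: i hi => // j _; apply: fib_gt0.
have x0 : (0 < fib (i - 3).+1)%N by apply: fib_gt0.
have wx : (fib (i - 3) <= fib (i - 3).+1)%N by apply: leq_fib.
(* In terms of F_(i-2) and F_(i-3), size conditions become comparisons of coefficients. *)
have aE := @fib_linear i (i - 3) 2 2 1 ltac:(lia) erefl erefl.
have bE := @fib_linear (i + 2) (i - 3) 4 5 3 ltac:(lia) erefl erefl.
have sq : (2 * fib (k - 2) <= fib k)%N.
  case: k hk => [|[|j]] // _; rewrite subn2 fibSS mul2n -addnn leq_add2r.
  exact: leq_fib.
split; last split; last split; last split; last split; last split; last split.
- move=> ik; apply: (@pFrobenius3_fib_criterion 3 i k (fib i).-1 3 0); [lia|lia| |lia].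
  have dE := @fib_linear (i + 3) (i - 3) 5 8 5 ltac:(lia) erefl erefl.
  have := leq_fib _ _ ik.
  by move=> ?; apply: extremal_case_a; lia.
- rewrite (_ : (2 * i + 2 = i + (i + 2))%N); last by lia.
  have eE := @fib_linear (i - 1) (i - 3) 1 1 1 ltac:(lia) erefl erefl.
  apply: (@pFrobenius3_fib_criterion 3 i (i + 2) (fib (i - 1)).-1 3 1); [lia|lia| |].
    have /(_ ltac:(lia) ltac:(lia) ltac:(lia)) := @extremal_case_b (fib i) (fib (i - 1)).
    by rewrite addnK; congr (extremal _ _ _ _ _ _ _ _); lia.
  (* F_(2i+2) stays opaque, tied to q b - s a; a polynomial identity remains. *)
  have := fib_skip2 i i; rewrite addnK -(addn2 i).
  rewrite predn_int; last by lia.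
  move: (fib (i + (i + 2))) => C; rewrite aE bE eE; lia.
- rewrite (_ : (2 * i + 1 = i + (i + 1))%N); last by lia.
  have eE := @fib_linear (i - 1) (i - 3) 1 1 1 ltac:(lia) erefl erefl.
  have sE := @fib_linear (i + 1 - 2) (i - 3) 1 1 1 ltac:(lia) erefl erefl.
  have fE := @fib_linear (i - 2) (i - 3) 0 1 0 ltac:(lia) erefl erefl.
  have qE := @fib_linear (i + 1) (i - 3) 3 3 2 ltac:(lia) erefl erefl.
  apply: (@pFrobenius3_fib_criterion 3 i (i + 1) (fib i).-1 2 1); [lia|lia| |].
    have /(_ ltac:(lia) ltac:(lia) ltac:(lia)) := @extremal_case_c (fib (i - 1)) (fib (i - 2)).
    by congr (extremal _ _ _ _ _ _ _ _); lia.
  have := fib_skip2 i (i + 1 - 2).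
  rewrite (_ : (i + 1 - 2).+2 = (i + 1)%N); last by lia.
  rewrite -(addn2 i) sE; rewrite predn_int; last by lia.
  move: (fib (i + (i + 1))) => C; rewrite aE bE fE qE; lia.
- rewrite (_ : (2 * i = i + i)%N); last by lia.
  have fE := @fib_linear (i - 2) (i - 3) 0 1 0 ltac:(lia) erefl erefl.
  apply: (@pFrobenius3_fib_criterion 3 i i (fib i).-1 2 2); [lia|lia| |].
    by apply: extremal_case_d; lia.
  have := fib_skip2 i (i - 2).
  rewrite (_ : (i - 2).+2 = i); last by lia.
  rewrite -(addn2 i) fE; rewrite predn_int; last by lia.
  move: (fib (i + i)) => C; rewrite aE bE; lia.
- move=> i4; rewrite (_ : (2 * i - 1 = i + (i - 1))%N); last by lia.
  (* h = F_(i-3) is positive since i >= 4; the base pair moves down by one index. *)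
  have h0 : (0 < fib (i - 4).+1)%N by apply: fib_gt0.
  have fE := @fib_linear (i - 2) (i - 4) 1 1 1 ltac:(lia) erefl erefl.
  have eE := @fib_linear (i - 1) (i - 4) 2 2 1 ltac:(lia) erefl erefl.
  have hE := @fib_linear (i - 3) (i - 4) 0 1 0 ltac:(lia) erefl erefl.
  have sE := @fib_linear (i - 1 - 2) (i - 4) 0 1 0 ltac:(lia) erefl erefl.
  have {}aE := @fib_linear i (i - 4) 3 3 2 ltac:(lia) erefl erefl.
  have {}bE := @fib_linear (i + 2) (i - 4) 5 8 5 ltac:(lia) erefl erefl.
  apply: (@pFrobenius3_fib_criterion 3 i (i - 1) (fib (i - 3)).-1 2 3); [lia|lia| |].
    have /(_ ltac:(lia) ltac:(lia)) := @extremal_case_e (fib (i - 2)) (fib (i - 3)).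
    by congr (extremal _ _ _ _ _ _ _ _); lia.
  have := fib_skip2 i (i - 1 - 2).
  rewrite (_ : (i - 1 - 2).+2 = (i - 1)%N); last by lia.
  rewrite -(addn2 i) sE hE; rewrite predn_int; last by lia.
  move: (fib (i + (i - 1))) => C; rewrite aE bE fE eE; lia.
- move=> i6; rewrite (_ : (2 * i - 2 = i + (i - 2))%N); last by lia.
  (* v = F_(i-5) is positive since i >= 6, and u - v = F_(i-6) <= v. *)
  have v0 : (0 < fib (i - 6).+1)%N by apply: fib_gt0.
  have wv : (fib (i - 6) <= fib (i - 6).+1)%N by apply: leq_fib.
  have vE := @fib_linear (i - 5) (i - 6) 0 1 0 ltac:(lia) erefl erefl.
  have uE := @fib_linear (i - 4) (i - 6) 1 1 1 ltac:(lia) erefl erefl.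
  have sE := @fib_linear (i - 2 - 2) (i - 6) 1 1 1 ltac:(lia) erefl erefl.
  have fE := @fib_linear (i - 2) (i - 6) 3 3 2 ltac:(lia) erefl erefl.
  have {}aE := @fib_linear i (i - 6) 5 8 5 ltac:(lia) erefl erefl.
  have {}bE := @fib_linear (i + 2) (i - 6) 7 21 13 ltac:(lia) erefl erefl.
  apply: (@pFrobenius3_fib_criterion 3 i (i - 2) (fib i).-1 1 5); [lia|lia| |].
    have /(_ ltac:(lia) ltac:(lia) ltac:(lia)) := @extremal_case_f (fib (i - 4)) (fib (i - 5)).
    by congr (extremal _ _ _ _ _ _ _ _); lia.
  have := fib_skip2 i (i - 2 - 2).
  rewrite (_ : (i - 2 - 2).+2 = (i - 2)%N); last by lia.
  rewrite -(addn2 i) sE; rewrite predn_int; last by lia.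
  move: (fib (i + (i - 2))) => C; rewrite aE bE vE fE; lia.
- split=> //.
  exact: (@pFrobenius3_fib_criterion 3 5 3 4 1 4 _ isT isT extremal_5_13_21).
- set r := ((fib i).-1 %/ fib k)%N => r3.
  have q0 : (0 < fib k)%N by case: k {sq r r3} hk => // j _; apply: fib_gt0.
  have s0 : (0 < fib (k - 2))%N.
    by rewrite (_ : (k - 2 = (k - 3).+1)%N); [apply: fib_gt0 | lia].
  have ab : (2 * fib i <= fib (i + 2))%N by lia.
  (* As r is the quotient of F_i - 1, the remainder w of F_i ranges over 1..q, not 0..q-1. *)
  have [w [w0 wq aw]] : exists w, [/\ (0 < w)%N, (w <= fib k)%N & fib i = (r * fib k + w)%N].
    have := divn_eq (fib i).-1 (fib k); have := ltn_pmod (fib i).-1 q0.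
    by rewrite -/r; clearbody r; move: (_ %% _)%N => y yk E; exists y.+1; split; lia.
  clearbody r.
  have wE : (fib i - r * fib k = w)%N by lia.
  have cE : (fib (i + k) + fib (k - 2) * fib i = fib k * fib (i + 2))%N.
    have := fib_skip2 i (k - 2).
    by rewrite (_ : (k - 2).+2 = k) ?addn2 //; lia.
  (* Products are atoms for [lia], so the needed nonlinear identities are supplied by hand. *)
  have rcE : (r * (fib (i + k) + fib (k - 2) * fib i) =
      r * (fib k * fib (i + 2)))%N by rewrite cE.
  have abE : (fib i * fib (i + 2) = (r * fib k + w) * fib (i + 2))%N.
    by rewrite -aw.
  (* The value b (w - 1) + c (r + 3) exceeds b (q - 1) + c (r + 2) by w b - s a, whose sign [hw]
     decides; m0 is chosen so that m0 + a attains the larger one. *)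
  rewrite wE; split=> hw.
    have m1 : ((3 * fib k).-1 + 1 * fib i = w.-1 + (r + 3) * fib k)%N by lia.
    have m2 : (w.-1 + (r + 3) * fib k = (fib k).-1 + (r + 2) * fib k + w)%N.
      by lia.
    apply: (@pFrobenius3_fib_criterion 3 i k (3 * fib k).-1 1 (r + 3)%N);
      [lia|lia| |].
      apply: (extremal_case_g _ _ _ _ _ _ _ _ aw) => //; lia.
    by rewrite predn_int; lia.
  have m1 : ((3 * fib k - w).-1 + 1 * fib i = (fib k).-1 + (r + 2) * fib k)%N.
    by lia.
  have m2 : (w.-1 + (r + 3) * fib k = (fib k).-1 + (r + 2) * fib k + w)%N.
    by lia.
  apply: (@pFrobenius3_fib_criterion 3 i k (3 * fib k - w).-1 1 (r + 2)%N);
    [lia|lia| |].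
    apply: (extremal_case_g _ _ _ _ _ _ _ _ aw) => //; lia.
  by rewrite predn_int; lia.
Qed.
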